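(* Let $K$ be a differential field of characteristic zero, let $R=K\{x_1,\ldots,x_n\}$, and let $u_1,u_2,\ldots,u_n\in R$ have order matrix $A=(a_{i,j})$, $a_{i,j}=\operatorname{ord}^{\partial}_{x_j}(u_i)$. Suppose that the system is in Ritt's second form, i.e. $$\operatorname{tdet}(A)=a_{1,n}+\Big(\sum_{i=2}^{n-1}a_{i,i}\Big)+a_{n,1},\qquad \operatorname{tdet}(\widetilde{A}_{n,n})=\sum_{i=1}^{n-1}a_{i,i}\ne-\infty,\qquad a_{n,1}=\max\{a_{1,1},a_{2,1},\ldots,a_{n,1}\},$$ where $\widetilde{A}_{n,n}$ is the matrix obtained from $A$ by deleting the $n$th row and $n$th column. Let $h=su_n-Qu_1$ be the Ritt remainder after $\partial$-division of $u_n$ by $u_1$ in the variable $x_1$ (so $s$ is in the multiplicative set generated by the separant of $u_1$ in $x_1$, and $Q\in R[\partial]$). Then $$J(u_1,u_2,\ldots,u_{n-1},h)\le J(u_1,u_2,\ldots,u_{n-1},u_n).$$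
   Context: $K\{x_1,\ldots,x_n\}$ is the ring of differential polynomials over the ordinary differential field $(K,\partial)$, with variables $x_j^{(r)}$, $r\ge0$. For $u\in R$, $\operatorname{ord}^{\partial}_{x_j}(u)=\max\{r\ge 0:\partial u/\partial x_j^{(r)}\neq 0\}$, where the maximum of the empty set is $-\infty$ in the strong convention and $0$ in the weak convention (either convention is fixed throughout). For a square matrix $A$ over $\mathbb{Z}_{\ge0}\cup\{-\infty\}$, $\operatorname{tdet}(A)=\max_{\rho}\sum_i a_{i,\rho(i)}$ over permutations $\rho$, with $-\infty+a=-\infty$. The Jacobi number $J(u_1,\ldots,u_n)$ is $\operatorname{tdet}$ of the order matrix of $(u_1,\ldots,u_n)$. $R[\partial]$ is the ring of linear differential operators over $R$ ($\partial r=\partial(r)+r\partial$), and $Qu_1$ denotes $Q$ applied to $u_1$. If $\operatorname{ord}^{\partial}_{x_1}(g)=a$ and $x_1^{(a)}$ occurs in $g$, the separant of $g$ in $x_1$ is $s_g=\partial g/\partial x_1^{(a)}$. Ritt $\partial$-division of $f$ by $g$ in $x_1$ is the following reduction using only separants: start with $h=f$; while $r=\operatorname{ord}^{\partial}_{x_1}(h)>a$, let $d=\deg_{x_1^{(r)}}h$ and let $c$ be the coefficient of $(x_1^{(r)})^d$ in $h$, and replace $h$ by $s_g h-c\,(x_1^{(r)})^{d-1}\partial^{\,r-a}(g)$. It terminates with a remainder $h=sf-Q(g)$ where $s$ is a power of $s_g$, $Q\in R[\partial]$, and $\operatorname{ord}^{\partial}_{x_1}(h)\le a$. *)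

(* Defs.v *)
From HB Require Import structures.
From mathcomp Require Import all_boot all_order all_fingroup all_algebra.
From mathcomp Require Import finmap.
From mathcomp Require Import monalg.

Set Implicit Arguments.
Unset Strict Implicit.
Unset Printing Implicit Defensive.

Import GRing.Theory.
Local Open Scope ring_scope.

(* [None] stands for -oo. *)
Notation trop := (option nat).

Definition tadd (x y : trop) : trop :=
  if x is Some m then if y is Some n then Some (m + n)%N else None else None.

Definition tmax (x y : trop) : trop :=
  if x is Some m then if y is Some n then Some (maxn m n) else x else y.

Definition tle (x y : trop) : bool :=
  if x is Some m then if y is Some n then (m <= n)%N else false else true.

Fact taddA : associative tadd.
Proof. by case=> [m|] [n|] [p|] //=; rewrite addnA. Qed.

Fact taddC : commutative tadd.
Proof. by case=> [m|] [n|] //=; rewrite addnC. Qed.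

Fact tadd0x : left_id (Some 0%N) tadd.
Proof. by case. Qed.

Fact tmaxA : associative tmax.
Proof. by case=> [m|] [n|] [p|] //=; rewrite maxnA. Qed.

Fact tmaxC : commutative tmax.
Proof. by case=> [m|] [n|] //=; rewrite maxnC. Qed.

Fact tmaxNx : left_id None tmax.
Proof. by case. Qed.

HB.instance Definition _ :=
  Monoid.isComLaw.Build trop (Some 0%N) tadd taddA taddC tadd0x.
HB.instance Definition _ :=
  Monoid.isComLaw.Build trop None tmax tmaxA tmaxC tmaxNx.

Fact tle_trans : transitive tle.
Proof. by case=> [n|] [m|] [p|] //=; apply: leq_trans. Qed.

Fact tle_maxl x y : tle x (tmax x y).
Proof. by case: x y => [m|] [n|] //=; apply: leq_maxl. Qed.

Fact tle_bigmax (I : eqType) (r : seq I) (P : pred I) (F : I -> trop) i :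
  i \in r -> P i -> tle (F i) (\big[tmax/None]_(k <- r | P k) F k).
Proof.
move=> ir Pi; elim: r ir => // k r IH; rewrite inE big_cons.
case/orP=> [/eqP <-|/IH le]; first by rewrite Pi tle_maxl.
by case: ifP => // _; apply: tle_trans le _; rewrite tmaxC tle_maxl.
Qed.

Definition tdet n (A : 'M[trop]_n) : trop :=
  \big[tmax/None]_(rho : 'S_n) \big[tadd/Some 0%N]_(i < n) A i (rho i).

Definition derivation (A : pzRingType) (d : A -> A) : Prop :=
  {morph d : x y / x + y} /\ forall x y, d (x * y) = d x * y + x * d y.

(* The variable x_j^{(r)} is indexed by the pair (j, r). *)
Definition dvar n : choiceType := Choice.clone ('I_n * nat)%type _.
Definition dmonom n : conomType := ConomialDef.clone (cmonom (dvar n)) _.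
Notation dpoly K n := {malg K[dmonom n]}.

Section DifferentialPolynomials.

Variables (K : fieldType) (n : nat).
Implicit Types (v : dvar n) (f g h : dpoly K n).

Definition dX v : dpoly K n := << ucm v >>.

Definition pderiv v f : dpoly K n :=
  \sum_(m <- msupp f) << f@_m *+ m v *g divcm m (ucm v) >>.

Definition degv v f : nat := \max_(m <- msupp f) m v.

(* The coefficient of x_v ^ d in f, seen as a polynomial in x_v over the ring
   generated by the other variables. *)
Definition coefv v (d : nat) f : dpoly K n :=
  \sum_(m <- msupp f | m v == d) << f@_m *g divcm m (expcmn (ucm v) d) >>.

(* The derivation extending [dK] and sending x_j^{(r)} to x_j^{(r+1)}:
   d (sum_m c_m m) = sum_m (dK c_m) m + sum_m c_m (sum_v (dm/dx_v) d(x_v)). *)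
Definition dder (dK : K -> K) f : dpoly K n :=
  \sum_(m <- msupp f)
    (<< dK f@_m *g m >> +
     \sum_(v <- finsupp m) pderiv v << f@_m *g m >> * dX (v.1, v.2.+1)).

(* An element of R[d] is written uniquely as sum_k q_k d^k, and is represented
   by the polynomial with coefficients q_k; only the left R-module structure of
   R[d] and its action on R are needed, so the product of {poly R}, which is
   not the one of R[d], plays no role. *)
Definition diffop := {poly dpoly K n}.

Definition diffop_app (dK : K -> K) (Q : diffop) f : dpoly K n :=
  \sum_(k < size Q) Q`_k * iter k (dder dK) f.

End DifferentialPolynomials.

Arguments diffop_app {K n}.

(* The value of the order in x_j when no x_j^{(r)} occurs: -oo or 0. *)
Variant convention := Strong | Weak.

Definition ord_empty (cv : convention) : trop :=
  if cv is Strong then None else Some 0%N.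

Section Order.

Variables (K : fieldType) (n : nat) (cv : convention).

(* A derivative df/dx_j^{(r)} can be nonzero only when x_j^{(r)} divides some
   monomial of f. *)
Definition dord (j : 'I_n) (f : dpoly K n) : trop :=
  tmax (ord_empty cv)
    (\big[tmax/None]_(m <- msupp f)
       \big[tmax/None]_(v <- finsupp m | (v.1 == j) && (pderiv v f != 0))
         Some v.2).

Definition ordmx (u : 'I_n -> dpoly K n) : 'M[trop]_n :=
  \matrix_(i, j) dord j (u i).

Definition jacobi_number (u : 'I_n -> dpoly K n) : trop := tdet (ordmx u).

End Order.

Section RittDivision.

Variables (K : fieldType) (n : nat) (cv : convention) (dK : K -> K).
Variables (j : 'I_n) (f g : dpoly K n).

(* [ritt_reduction a s Q h]: h is reached from f by reduction steps by g in
   x_j, where a is the order of g in x_j; s and Q record h = s f - Q(g). *)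
Inductive ritt_reduction (a : nat) :
    dpoly K n -> diffop K n -> dpoly K n -> Prop :=
| ritt_start : ritt_reduction a 1 0 f
| ritt_step s Q h r :
    ritt_reduction a s Q h ->
    dord cv j h = Some r -> (a < r)%N ->
    let sg := pderiv (j, a) g in
    let d := degv (j, r) h in
    let q := coefv (j, r) d h * dX K (j, r) ^+ d.-1 in
    ritt_reduction a (sg * s) (sg *: Q + q *: 'X^(r - a))
      (sg * h - q * iter (r - a) (dder dK) g).

(* The division is defined only when x_j^{(a)} occurs in g (a restriction in
   the weak convention, where a may be 0 although x_j does not occur). *)
Definition ritt_remainder s Q h : Prop :=
  exists a, [/\ dord cv j g = Some a, pderiv (j, a) g != 0,
                ritt_reduction a s Q h & tle (dord cv j h) (Some a)].

End RittDivision.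

Definition replace_last n (T : Type) (u : 'I_n.+1 -> T) (h : T) : 'I_n.+1 -> T :=
  fun i => if i == ord_max then h else u i.

(* The rows and columns 1, ..., n of the matrix are indexed from [ord0] to
   [ord_max]. *)
Definition ritt_second_form n (A : 'M[trop]_n.+1) : Prop :=
  [/\ tdet A =
        tadd (tadd (A ord0 ord_max)
                (\big[tadd/Some 0%N]_(i | (i != ord0) && (i != ord_max)) A i i))
             (A ord_max ord0),
      tdet (row' ord_max (col' ord_max A)) =
        \big[tadd/Some 0%N]_(i | i != ord_max) A i i,
      \big[tadd/Some 0%N]_(i | i != ord_max) A i i != None
    & A ord_max ord0 = \big[tmax/None]_i A i ord0].

Section DifferentialPolynomialsTheory.

Variables (K : fieldType) (n : nat).
Implicit Types (v w : dvar n) (f g h : dpoly K n) (m : dmonom n).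

Lemma big_msupp (V : nmodType) (F : dmonom n -> K -> V)
    (d : {fset dmonom n}) f :
  (forall m, F m 0 = 0) -> (msupp f `<=` d)%fset ->
  \sum_(m <- msupp f) F m f@_m = \sum_(m <- d) F m f@_m.
Proof.
move=> F0 sfd; apply: big_fset_incl => // m _ mNf.
by rewrite mcoeff_outdom // F0.
Qed.

Lemma big_msuppD (V : nmodType) (F : dmonom n -> K -> V) f g :
  (forall m, F m 0 = 0) -> (forall m, {morph F m : x y / x + y}) ->
  \sum_(m <- msupp (f + g)) F m (f + g)@_m =
  \sum_(m <- msupp f) F m f@_m + \sum_(m <- msupp g) F m g@_m.
Proof.
move=> F0 FD.
rewrite !(@big_msupp _ F (msupp f `|` msupp g)%fset) ?fsubsetUl ?fsubsetUr //.
  by rewrite -big_split; apply: eq_bigr => m _; rewrite mcoeffD FD.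
exact: msuppD_le.
Qed.

Lemma big_msuppU (V : nmodType) (F : dmonom n -> K -> V) m c :
  (forall m, F m 0 = 0) ->
  \sum_(k <- msupp (<< c *g m >> : dpoly K n)) F k << c *g m >>@_k = F m c.
Proof.
move=> F0; rewrite (@big_msupp _ F [fset m]%fset) ?msuppU_le //.
by rewrite big_seq_fset1 mcoeffUU.
Qed.

Lemma derivation_monom (d : dpoly K n -> dpoly K n) :
  {morph d : f g / f + g} ->
  (forall b c k m, d (<< b *g k >> * << c *g m >>) =
     d << b *g k >> * << c *g m >> + << b *g k >> * d << c *g m >>) ->
  derivation d.
Proof.
move=> dD dU; split=> // f g.
have d0 : d 0 = 0 by apply: (addrI (d 0)); rewrite -dD !addr0.
have dsum (r : seq (dmonom n)) F :
    d (\sum_(m <- r) F m) = \sum_(m <- r) d (F m).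
  by elim: r => [|m r IH]; rewrite ?big_nil // !big_cons dD IH.
have dUr b k : d (<< b *g k >> * g) = d << b *g k >> * g + << b *g k >> * d g.
  rewrite [g]monalgE mulr_sumr !dsum [X in _ = X + _]mulr_sumr.
  rewrite [X in _ = _ + X]mulr_sumr -big_split /=.
  by apply: eq_bigr => m _; rewrite dU.
rewrite [f]monalgE mulr_suml !dsum [X in _ = X + _]mulr_suml.
rewrite [X in _ = _ + X]mulr_suml -big_split /=.
by apply: eq_bigr => m _; rewrite dUr.
Qed.

Lemma pderivU v m c :
  pderiv v << c *g m >> = << c *+ m v *g divcm m (ucm v) >> :> dpoly K n.
Proof.
rewrite /pderiv (big_msuppU (F := fun k x => << x *+ k v *g divcm k (ucm v) >>)) //.
by move=> k; rewrite mul0rn monalgU0.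
Qed.

Lemma pderivD v : {morph @pderiv K n v : f g / f + g}.
Proof.
move=> f g.
rewrite /pderiv (big_msuppD (F := fun k x => << x *+ k v *g divcm k (ucm v) >>)) //.
  by move=> k; rewrite mul0rn monalgU0.
by move=> k x y; rewrite mulrnDl monalgUD.
Qed.

Lemma monalgMUU m k (b c : K) :
  << b *g m >> * << c *g k >> = << b * c *g mmul m k >> :> dpoly K n.
Proof. by rewrite malgM_def fgmulUU. Qed.

Lemma monalgDU m (b c : K) :
  << b + c *g m >> = << b *g m >> + << c *g m >> :> dpoly K n.
Proof. exact: monalgUD. Qed.

Lemma divcmMl v m k : (0 < m v)%N ->
  divcm (mmul m k) (ucm v) = mmul (divcm m (ucm v)) k.
Proof.
move=> mv; apply/eqP/cmP => i; rewrite divcmE !cmM divcmE cmU.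
by case: eqP => [<-|_] /=; rewrite ?subn0 // addnC -addnBA // addnC.
Qed.

Lemma pderivM v : derivation (@pderiv K n v).
Proof.
apply: derivation_monom; first exact: pderivD.
move=> b c k m; rewrite [X in pderiv v X]monalgMUU [LHS]pderivU.
rewrite [X in _ = X * _ + _]pderivU [X in _ = _ + _ * X]pderivU.
rewrite [X in _ = X + _]monalgMUU [X in _ = _ + X]monalgMUU.
have -> : b * c *+ mmul k m v = (b *+ k v) * c + b * (c *+ m v).
  by rewrite cmM mulrnDr mulrnAl mulrnAr.
apply: etrans (monalgDU _ _ _) _; apply: congr2.
  have [->|kv] := posnP (k v); first by rewrite mulr0n mul0r !monalgU0.
  by rewrite (divcmMl _ kv).
have [->|mv] := posnP (m v); first by rewrite mulr0n mulr0 !monalgU0.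
by rewrite mulmC (divcmMl _ mv) mulmC.
Qed.

Lemma pderivC v c : pderiv v (c%:MP : dpoly K n) = 0.
Proof. by rewrite pderivU cm1 mulr0n monalgU0. Qed.

Lemma pderivX v w : pderiv v (dX K w) = (w == v)%:R.
Proof.
rewrite pderivU cmU; case: eqP => [->|_]; last by rewrite mulr0n monalgU0.
have -> : divcm (ucm v) (ucm v) = mone.
  by apply/eqP/cmP => i; rewrite divcmE subnn cm1.
by [].
Qed.

Section DDer.

Variable dK : K -> K.
Hypothesis dK_der : derivation dK.

Let dK0 : dK 0 = 0.
Proof. by apply: (addrI (dK 0)); rewrite -dK_der.1 !addr0. Qed.

Let F m (c : K) : dpoly K n := << dK c *g m >> +
     \sum_(v <- finsupp m) pderiv v << c *g m >> * dX K (v.1, v.2.+1).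

Let F0 m : F m 0 = 0.
Proof.
rewrite /F dK0 !monalgU0 add0r big1 // => v _.
by rewrite /pderiv msupp0 big_nil mul0r.
Qed.

Let FD m : {morph F m : x y / x + y}.
Proof.
move=> x y; rewrite /F dK_der.1 !monalgUD addrACA -big_split /=.
by congr (_ + _); apply: eq_bigr => v _; rewrite pderivD mulrDl.
Qed.

Let FE m c (d : {fset dvar n}) : (finsupp m `<=` d)%fset -> F m c = << dK c *g m >> +
     \sum_(v <- d) pderiv v << c *g m >> * dX K (v.1, v.2.+1).
Proof.
move=> sd; congr (_ + _); apply: big_fset_incl => // v _.
by rewrite -cmE_eq0 => /eqP mv; rewrite pderivU mv mulr0n monalgU0 mul0r.
Qed.

Lemma dderU c m : dder dK << c *g m >> = << dK c *g m >> +
     \sum_(v <- finsupp m) pderiv v << c *g m >> * dX K (v.1, v.2.+1).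
Proof. exact: (big_msuppU (F := F)). Qed.

Lemma dderM : derivation (@dder K n dK).
Proof.
apply: derivation_monom; first by move=> f g; apply: (big_msuppD (F := F)).
move=> b c k m; rewrite [X in dder dK X]monalgMUU.
pose d := (finsupp k `|` finsupp m)%fset.
pose S x := \sum_(v <- d) pderiv v x * dX K (v.1, v.2.+1).
have E (k' : dmonom n) (x : K) : (finsupp k' `<=` d)%fset ->
    dder dK << x *g k' >> = << dK x *g k' >> + S << x *g k' >>.
  by move=> sd; rewrite dderU; apply: FE.
have E0 : dder dK << b * c *g mmul k m >> =
    << dK (b * c) *g mmul k m >> + S << b * c *g mmul k m >>.
  by apply: E; rewrite (mdomD k m).
have E1 := E _ b (fsubsetUl _ _); have E2 := E _ c (fsubsetUr _ _).
rewrite [LHS]E0 [X in _ = X * _ + _]E1 [X in _ = _ + _ * X]E2.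
have SM f g : S (f * g) = S f * g + f * S g.
  rewrite /S mulr_suml mulr_sumr -big_split; apply: eq_bigr => v _ /=.
  have aux (A : comPzRingType) (x y z p q : A) :
      (x * q + p * y) * z = x * z * q + p * (y * z).
    by rewrite mulrDl mulrAC mulrA.
  by rewrite [X in X * _ = _](pderivM v).2; apply: aux.
have -> : << b * c *g mmul k m >> = << b *g k >> * << c *g m >> :> dpoly K n.
  by rewrite monalgMUU.
have -> : << dK (b * c) *g mmul k m >> =
    << dK b *g k >> * << c *g m >> + << b *g k >> * << dK c *g m >> :> dpoly K n.
  rewrite dK_der.2; apply: etrans (monalgDU _ _ _) _.
  by apply: congr2; rewrite monalgMUU.
have aux (A : comPzRingType) (p q x y z t : A) :
    (x * q + p * y) + (z * q + p * t) = (x + z) * q + p * (y + t).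
  by rewrite mulrDl mulrDr addrACA.
by rewrite SM; apply: aux.
Qed.

Lemma dderC c : dder dK (c%:MP : dpoly K n) = (dK c)%:MP.
Proof. by rewrite dderU mdom1 big_seq_fset0 addr0. Qed.

Lemma dderX v : dder dK (dX K v) = dX K (v.1, v.2.+1).
Proof.
have dK1 : dK 1 = 0.
  by apply: (addrI (dK 1)); have := dK_der.2 1 1; rewrite !mulr1 mul1r addr0.
by rewrite dderU dK1 monalgU0 add0r mdomU big_seq_fset1 pderivX eqxx mul1r.
Qed.

End DDer.

Lemma coefvE v f :
  f = \sum_(d < (degv v f).+1) coefv v d f * dX K v ^+ d.
Proof.
have expS d : expcmn (ucm v) d.+1 = mmul (ucm v) (expcmn (ucm v) d).
  by case: d => [|d] //; apply/esym/mulm1.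
have XE d : dX K v ^+ d = << expcmn (ucm v) d >>.
  elim: d => [|d IH]; first by rewrite expr0.
  rewrite exprS IH expS.
  exact: etrans (monalgMUU _ _ 1 1) (congr1 (mkmalgU _) (mulr1 1)).
have expE d i : expcmn (ucm v) d i = ((v == i) * d)%N.
  elim: d => [|d IH]; first by rewrite muln0 cm1.
  by rewrite expS cmM IH cmU mulnS.
have lt_m m : m \in msupp f -> (m v < (degv v f).+1)%N.
  by move=> mf; rewrite ltnS; apply: (leq_bigmax_seq (P := xpredT)).
pose G m (d : nat) := if m v == d
  then << f@_m *g divcm m (expcmn (ucm v) d) >> * dX K v ^+ d else 0.
have GE d : coefv v d f * dX K v ^+ d = \sum_(m <- msupp f) G m d.
  by rewrite /coefv mulr_suml big_mkcond.
transitivity (\sum_(d < (degv v f).+1) \sum_(m <- msupp f) G m d); last first.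
  by apply: eq_bigr => d _; rewrite GE.
rewrite [LHS]monalgE exchange_big /=.
rewrite [LHS]big_seq [RHS]big_seq; apply: eq_bigr => m mf.
rewrite (bigD1 (Ordinal (lt_m m mf))) //= big1 => [|d dm]; last first.
  by rewrite /G; case: eqP => // e; case/eqP: dm; apply: val_inj.
rewrite addr0 /G eqxx XE; apply: esym; apply: etrans (monalgMUU _ _ _ _) _.
apply: congr2; last exact: mulr1.
apply/eqP/cmP => i; rewrite cmM divcmE expE.
by case: eqP => [->|_]; rewrite ?mul1n ?subnn // mul0n subn0 addn0.
Qed.

Lemma pderiv_neq0_supp v f : pderiv v f != 0 ->
  exists2 m, m \in msupp f & v \in finsupp m.
Proof.
move=> nz; have : ~~ all (fun m => m v == 0%N) (msupp f).
  apply: contra nz => /allP all0; rewrite /pderiv big_seq big1 // => m /all0/eqP->.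
  by rewrite mulr0n monalgU0.
by case/allPn => m mf; rewrite cmE_neq0; exists m.
Qed.

Lemma dordP cv j f :
  (exists r, [/\ dord cv j f = Some r, pderiv (j, r) f != 0
               & forall s, pderiv (j, s) f != 0 -> (s <= r)%N])
  \/ (forall s, pderiv (j, s) f = 0) /\ dord cv j f = ord_empty cv.
Proof.
pose B m := \big[tmax/None]_(v <- finsupp m | (v.1 == j) && (pderiv v f != 0))
  Some v.2.
have -> : dord cv j f = tmax (ord_empty cv) (\big[tmax/None]_(m <- msupp f) B m).
  by [].
have ub s : pderiv (j, s) f != 0 ->
    tle (Some s) (\big[tmax/None]_(m <- msupp f) B m).
  move=> nz; have [m mf vm] := pderiv_neq0_supp nz.
  apply: tle_trans (tle_bigmax B mf isT).
  by apply: (tle_bigmax (fun v : dvar n => Some v.2) vm); rewrite eqxx nz.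
have [] : \big[tmax/None]_(m <- msupp f) B m = None \/
    exists2 r, \big[tmax/None]_(m <- msupp f) B m = Some r & pderiv (j, r) f != 0.
  pose P (N : nat -> bool) (x : trop) := x = None \/ exists2 r, x = Some r & N r.
  have Pmax N x y : P N x -> P N y -> P N (tmax x y).
    case=> [->|[r -> nr]]; first by rewrite tmaxNx.
    case=> [->|[t -> nt]]; right; first by exists r.
    by exists (maxn r t); rewrite // /maxn; case: ifP.
  apply: (big_ind (P (fun r => pderiv (j, r) f != 0))); first by left.
    exact: Pmax.
  move=> m _; apply: (big_ind (P (fun r => pderiv (j, r) f != 0))).
  - by left.
  - exact: Pmax.
  - by move=> [i r] /andP[/= /eqP-> nz]; right; exists r.
- move=> E; right; split; last by rewrite E; case: cv.
  by move=> s; apply/eqP/negP => /negP/ub; rewrite E.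
- case=> r E nz; left; exists r; split=> //; first by rewrite E; case: cv => //=; rewrite max0n.
  by move=> s /ub; rewrite E.
Qed.

Section Ritt.

Variables (dK : K -> K) (cv : convention).

Lemma diffop_appE (N : nat) (Q : diffop K n) f : (size Q <= N)%N ->
  diffop_app dK Q f = \sum_(k < N) Q`_k * iter k (dder dK) f.
Proof.
move=> sQ; rewrite /diffop_app.
rewrite (big_ord_widen N (fun k => Q`_k * iter k (dder dK) f) sQ) big_mkcond /=.
apply: eq_bigr => k _; case: ltnP => // ge; by rewrite nth_default ?mul0r.
Qed.

Lemma ritt_reductionE j f g a s Q h :
  ritt_reduction cv dK j f g a s Q h ->
  h = s * f - diffop_app dK Q g /\ exists k, s = pderiv (j, a) g ^+ k.
Proof.
elim=> [|{s Q h} s Q h r _ [-> [k ->]] _ _ sg d q].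
  rewrite mul1r /diffop_app size_poly0 big_ord0 subr0; split=> //.
  by exists 0%N; rewrite expr0.
split; last by exists k.+1; rewrite exprS.
pose N := maxn (size (sg *: Q + q *: 'X^(r - a))) (maxn (size Q) (r - a).+1).
have lt_N : (r - a < N)%N by rewrite !leq_max leqnn !orbT.
rewrite (@diffop_appE N) ?leq_max ?leqnn ?orbT //.
rewrite (@diffop_appE N (_ + _)) ?leq_max ?leqnn //.
have aux (A : comNzRingType) (F : nat -> A) (P : {poly A}) (b c x : A) e :
    (e < N)%N -> b * (x - \sum_(k < N) P`_k * F k) - c * F e =
    b * x - \sum_(k < N) (b *: P + c *: 'X^e)`_k * F k.
  move=> lt_e; rewrite mulrBr -addrA -opprD; congr (_ - _).
  under [RHS]eq_bigr do rewrite coefD !coefZ mulrDl.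
  rewrite big_split mulr_sumr /=; congr (_ + _).
    by apply: eq_bigr => i _; rewrite mulrA.
  rewrite (bigD1 (Ordinal lt_e)) //= coefXn eqxx mulr1 big1 ?addr0 // => i ne.
  rewrite coefXn; case: eqP => [E|]; last by rewrite mulr0 mul0r.
  by case/eqP: ne; apply: val_inj.
rewrite -[X in _ = X - _]mulrA; exact: aux.
Qed.

Lemma ritt_remainderE j f g s Q h :
  ritt_remainder cv dK j f g s Q h ->
  h = s * f - diffop_app dK Q g /\
  exists a k, dord cv j g = Some a /\ s = pderiv (j, a) g ^+ k.
Proof.
case=> a [ga _ /ritt_reductionE[-> [k ->]] _].
by split=> //; exists a, k.
Qed.

End Ritt.

End DifferentialPolynomialsTheory.

(* Main.v *)
Require Import Defs.
From mathcomp Require Import all_boot all_order all_fingroup all_algebra.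
From mathcomp Require Import finmap.
From mathcomp Require Import monalg.
From mathcomp Require Import zify ring.

Set Implicit Arguments.
Unset Strict Implicit.
Unset Printing Implicit Defensive.

Import GRing.Theory.
Local Open Scope ring_scope.

(** Let a be the order of u_1 in x_1 and a + e that of u_n, the largest entry of
    the first column of the order matrix A. During the division of u_n by u_1
    the order in x_1 never exceeds a + e, so that u_1 is differentiated at most
    e times. Since differentiation raises every order by at most one, and
    separants, coefficients and products do not raise orders, the order of h in
    x_j is at most the maximum of a_{n,j} and a_{1,j} + e for every j
    ([ritt_reduction_ord]).

    What remains is a statement on tropical matrices ([tdet_replace_last]). Fix
    a permutation rho. If the order of h in x_{rho(n)} is bounded by
    a_{n,rho(n)}, the weight of rho is at most its weight in A. Otherwise it is
    at most e plus the weight w of rho in the matrix obtained from A by putting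
    a second copy of row 1 in place of row n. (For n = 1 this changes nothing,
    and e = 0.) For n > 1, identify this copy with row 1, and draw an arrow from
    i to rho(i) for each row i: vertex 1 has out-degree 2, vertex n has
    out-degree 0, the other out-degrees and all in-degrees are 1.
    The arrows thus form a path from 1 to n and cycles disjoint from the
    interior of the path, one of which passes through 1 ([porbit_weights]).
    Write D for the sum of the a_{i,i} with 1 < i < n. The path, completed by
    diagonal entries and by the arrow from n to 1, is a permutation of A, so its
    weight without that arrow is at most a_{1,n} + D. The cycles, completed by
    diagonal entries, form a permutation of the leading block, so their weight
    is at most a_{1,1} + D. The diagonal entries used for completion add up to
    D, hence w + D <= (a_{1,n} + D) + (a_{1,1} + D). As D is finite,
    w + e <= a_{1,n} + D + a_{1,1} + e = a_{1,n} + D + a_{n,1} = tdet A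
    ([ritt_second_form_double]). *)

(** * Tropical determinants and cycles of permutations *)

Lemma tle_bigmaxP (I : Type) (r : seq I) (P : pred I) (F : I -> trop) x :
  (forall i, P i -> tle (F i) x) -> tle (\big[tmax/None]_(i <- r | P i) F i) x.
Proof.
move=> Fx; apply: (big_ind (tle^~ x)) => //.
by case: x {Fx} => [m|] [p|] [q|] //=; rewrite geq_max => -> ->.
Qed.

Lemma tle_tdet n (A : 'M[trop]_n) (rho : 'S_n) :
  tle (\big[tadd/Some 0%N]_i A i (rho i)) (tdet A).
Proof.
by apply: (tle_bigmax (fun s : 'S_n => \big[tadd/Some 0%N]_i A i (s i)));
  rewrite // mem_index_enum.
Qed.

(** By the count of cycles, multiplying by a transposition of two points of one
    cycle creates a cycle, which can only come from separating the two points: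
    multiplying once more gives back [s], hence must merge two cycles. *)
Lemma porbit_tperm_notin (T : finType) (s : {perm T}) (x y : T) :
  x != y -> x \in porbit s y -> x \notin porbit (tperm x y * s) y.
Proof.
move=> xy xs; set t := (tperm x y * s)%g.
have ts : (tperm x y * t)%g = s by rewrite /t mulgA tperm2 mul1g.
have /= := porbits_mul_tperm s x y; rewrite -/t xs xy addn0 => E.
have /= := porbits_mul_tperm t x y; rewrite ts E xy /=.
by case: (x \notin _) => //=; lia.
Qed.

Lemma porbit_stable (T : finType) (s : {perm T}) (x i : T) :
  (s i \in porbit s x) = (i \in porbit s x).
Proof.
rewrite -!eq_porbit_mem; congr (_ == _).
by have := porbit_perm s 1 i; rewrite expg1.
Qed.

Section Restriction.

Variables (T : finType) (s : {perm T}) (S : {set T}).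
Hypothesis sS : forall i, (s i \in S) = (i \in S).

Let on_fun i := if i \in S then s i else i.

Fact perm_restrict_subproof : injective on_fun.
Proof.
move=> i k; rewrite /on_fun; case: ifP => iS; case: ifP => kS //.
- exact: perm_inj.
- by move=> E; rewrite -sS E kS in iS.
- by move=> E; rewrite -sS -E iS in kS.
Qed.

Definition perm_restrict := perm perm_restrict_subproof.

Lemma perm_restrictE i : perm_restrict i = if i \in S then s i else i.
Proof. by rewrite permE. Qed.

End Restriction.

(** Row [q] is treated as a second copy of row [p], so that the right-hand side
    is the weight of [rho] in a matrix with row [p] doubled, completed by
    diagonal entries. Read as a graph with an arrow from [i] to [rho i], this is
    a path from [p] to [q], namely the cycle of [q] with its first arrow
    starting at [p] instead, together with cycles. Closing the path up by
    [q |-> p] and fixing the other points gives [sigma]; keeping only the cycles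
    and fixing the points of the path gives [tau]. *)
Lemma porbit_weights n (A : 'M[trop]_n) (p q : 'I_n) (rho : 'S_n) :
  p != q -> p \notin porbit rho q ->
  exists sigma tau : 'S_n, [/\ sigma q = p, tau q = q &
    tadd (\big[tadd/Some 0%N]_(i | i != q) A i (sigma i))
         (\big[tadd/Some 0%N]_(i | i != q) A i (tau i)) =
    tadd (tadd (\big[tadd/Some 0%N]_(i | i != q) A i (rho i)) (A p (rho q)))
         (\big[tadd/Some 0%N]_(i | (i != p) && (i != q)) A i i)].
Proof.
move=> pq pS; set S := porbit rho q in pS.
have qS : q \in S by apply: porbit_id.
have rS i : (rho i \in S) = (i \in S) by apply: porbit_stable.
have rC i : (rho i \in ~: S) = (i \in ~: S) by rewrite !inE rS.
exists (tperm p q * perm_restrict rS)%g, (perm_restrict rC).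
split; rewrite ?permM ?tpermR ?perm_restrictE ?(negPf pS) //.
  by rewrite inE qS.
rewrite (bigD1 p) ?pq //= permM tpermL perm_restrictE qS.
rewrite [X in _ = tadd (tadd X _) _](bigD1 p) ?pq //=.
rewrite [X in tadd _ X = _](bigD1 p) ?pq //= perm_restrictE inE pS /=.
(* Off [p] and [q], one of [sigma], [tau] follows [rho] and the other is the
   identity. *)
have E : tadd
    (\big[tadd/Some 0%N]_(i | (i != q) && (i != p))
       A i ((tperm p q * perm_restrict rS)%g i))
    (\big[tadd/Some 0%N]_(i | (i != q) && (i != p)) A i (perm_restrict rC i)) =
  tadd (\big[tadd/Some 0%N]_(i | (i != q) && (i != p)) A i (rho i))
    (\big[tadd/Some 0%N]_(i | (i != q) && (i != p)) A i i).
  rewrite -!big_split; apply: eq_bigr => i /andP[iq ip] /=.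
  rewrite permM tpermD ?[_ == i]eq_sym // !perm_restrictE inE.
  by case: (i \in S) => //=; rewrite taddC.
rewrite [X in _ = tadd _ X](eq_bigl (fun i => (i != q) && (i != p)));
  last by move=> i; rewrite andbC.
move: E; do ![move: (bigop.body _ _ _)] => a b c d E.
move: E; case: a b c d (A p (rho q)) (A p (rho p))
  => [a|] [b|] [c|] [d|] [x|] [y|] //=.
by case=> E; congr Some; lia.
Qed.

Lemma tdet_unlift n (A : 'M[trop]_n.+1) (k : 'I_n.+1) (tau : 'S_n.+1) :
  tau k = k ->
  tle (\big[tadd/Some 0%N]_(i | i != k) A i (tau i))
      (tdet (row' k (col' k A))).
Proof.
move=> tk; pose t i := odflt i (unlift k (tau (lift k i))).
have tE i : lift k (t i) = tau (lift k i).
  rewrite /t; case: unliftP => [j -> //|] E.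
  have /perm_inj/eqP := etrans E (esym tk).
  by rewrite eq_sym (negPf (neq_lift k i)).
have t_inj : injective t.
  move=> i j /(congr1 (lift k)); rewrite !tE => /perm_inj; exact: lift_inj.
have -> : \big[tadd/Some 0%N]_(i | i != k) A i (tau i) =
    \big[tadd/Some 0%N]_i row' k (col' k A) i (perm t_inj i).
  rewrite [LHS](reindex_omap (lift k) (unlift k)) /=; last first.
    by move=> i ik; case: unliftP => [j -> //|ki]; rewrite ki eqxx in ik.
  apply: eq_big => i; first by rewrite liftK eqxx andbT eq_sym neq_lift.
  by move=> _; rewrite !mxE permE tE.
exact: tle_tdet.
Qed.

(** In a matrix in Ritt's second form, double the first row in place of the last
    one. No permutation of the result weighs more than [A ord0 ord_max] plus the
    diagonal of the leading block, the excess [e] of [A ord_max ord0] over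
    [A ord0 ord0] being exactly what turns this bound into [tdet A]: the
    permutation splits into one completed by [A ord_max ord0], bounded by
    [tdet A], and one fixing the last index, bounded by the weight of that
    diagonal. *)
Lemma ritt_second_form_double n (A : 'M[trop]_n.+1) (a e : nat)
    (rho : 'S_n.+1) :
  ritt_second_form A ->
  A ord0 ord0 = Some a -> A ord_max ord0 = Some (a + e)%N ->
  tle (tadd (tadd (\big[tadd/Some 0%N]_(i | i != ord_max) A i (rho i))
                  (A ord0 (rho ord_max))) (Some e)) (tdet A).
Proof.
move=> [tA tA' D_fin _] a00 aN0.
have [E|neq0N] := eqVneq (ord0 : 'I_n.+1) ord_max.
  rewrite -E in aN0 *; rewrite a00 in aN0.
  have -> : e = 0%N by case: aN0; lia.
  rewrite taddC tadd0x; apply: tle_trans (tle_tdet A rho).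
  rewrite [X in tle _ X](bigD1 ord0) //= taddC.
  by case: (tadd _ _) => /=.
(* Both copies of row [ord0] have the same entries, so their images can be
   exchanged, which separates [ord0] and [ord_max]. *)
wlog N0 : rho / ord0 \notin porbit rho ord_max.
  move=> IH; have [in0|] := boolP (ord0 \in porbit rho ord_max); last exact: IH.
  have := IH _ (porbit_tperm_notin neq0N in0).
  rewrite permM tpermR (bigD1 ord0) //= permM tpermL.
  rewrite [X in _ -> tle (tadd (tadd X _) _) _](bigD1 ord0) //=.
  rewrite (eq_bigr (fun i => A i (rho i))); last first.
    by move=> i /andP[iN i0]; rewrite permM tpermD // eq_sym.
  congr (tle (tadd _ _) _).
  by rewrite taddC -taddA; congr tadd; rewrite taddC.
have [sigma [tau [sN tN wE]]] := porbit_weights A neq0N N0.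
have := tdet_unlift A tN; rewrite tA' => le_tau.
have := tle_tdet A sigma; rewrite (bigD1 ord_max) //= sN => le_sigma.
have DE : \big[tadd/Some 0%N]_(i | i != ord_max) A i i = tadd (A ord0 ord0)
    (\big[tadd/Some 0%N]_(i | (i != ord0) && (i != ord_max)) A i i).
  by rewrite (bigD1 ord0) //=; congr tadd; apply: eq_bigl => i; rewrite andbC.
rewrite DE in le_tau D_fin; rewrite tA in le_sigma *.
(* The remaining diagonal weight [M] occurs on both sides of [wE], and cancels
   because it is finite. *)
move: wE le_tau le_sigma D_fin; rewrite aN0 a00.
do ![move: (bigop.body _ _ _)] => ws wt wr M.
case: M ws wt wr (A ord0 ord_max) (A ord0 (rho ord_max))
  => [M|] [ws|] [wt|] [wr|] [x|] [y|] //=.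
by case=> E; lia.
Qed.

(** A permutation of [B] takes in the last row either an entry bounded by that
    of [A], and is bounded as in [A], or an entry bounded by that of the first
    row raised by [e], and [ritt_second_form_double] applies. *)
Lemma tdet_replace_last n (A B : 'M[trop]_n.+1) (a e : nat) :
  ritt_second_form A ->
  A ord0 ord0 = Some a -> A ord_max ord0 = Some (a + e)%N ->
  (forall i j, i != ord_max -> B i j = A i j) ->
  (forall j,
     tle (B ord_max j) (tmax (A ord_max j) (tadd (A ord0 j) (Some e)))) ->
  tle (tdet B) (tdet A).
Proof.
move=> A2 a00 aN0 BA BN; apply: tle_bigmaxP => rho _.
have := ritt_second_form_double rho A2 a00 aN0.
have := tle_tdet A rho.
have := BN (rho ord_max).
rewrite (bigD1 ord_max) //= [X in _ -> _ -> _ -> tle X _](bigD1 ord_max) //=.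
rewrite [X in _ -> _ -> _ -> tle (tadd _ X) _](eq_bigr (fun i => A i (rho i))).
  move: (tdet A) (bigop.body _ _ _).
  case: (A ord0 _) (A ord_max _) (B _ _) => [x|] [y|] [z|] [d|] [w|] //=; lia.
by move=> i /BA ->.
Qed.

(** * Derivations of a commutative ring *)

Section Derivations.

Variable A : comNzRingType.
Implicit Types d : A -> A.

Lemma derivation0 d : derivation d -> d 0 = 0.
Proof. by case=> dD _; apply: (addrI (d 0)); rewrite -dD !addr0. Qed.

Lemma derivation_nat d k : derivation d -> d k%:R = 0.
Proof.
move=> dd; have d1 : d 1 = 0.
  by apply: (addrI (d 1)); have := dd.2 1 1; rewrite !mulr1 mul1r addr0.
elim: k => [|k IH]; first exact: derivation0.
by rewrite -addn1 natrD dd.1 IH add0r.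
Qed.

Lemma derivation_zero : derivation (fun=> 0 : A).
Proof. by split=> x y; rewrite ?addr0 // mul0r mulr0 addr0. Qed.

Lemma derivation_bracket d e :
  derivation d -> derivation e -> derivation (fun x => d (e x) - e (d x)).
Proof.
move=> dd de; split=> x y.
  by rewrite dd.1 de.1 dd.1 de.1; ring.
by rewrite dd.2 de.2 dd.1 de.1 !(dd.2, de.2); ring.
Qed.

Lemma derivation_kerM d x y :
  derivation d -> d x = 0 -> d y = 0 -> d (x * y) = 0.
Proof. by move=> dd dx dy; rewrite dd.2 dx dy mul0r mulr0 addr0. Qed.

Lemma derivation_kerB d x y :
  derivation d -> d x = 0 -> d y = 0 -> d (x - y) = 0.
Proof.
by move=> dd dx dy; apply: (addIr (d y)); rewrite -dd.1 subrK dx dy addr0.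
Qed.

Lemma derivation_kerX d x k : derivation d -> d x = 0 -> d (x ^+ k) = 0.
Proof.
move=> dd dx; elim: k => [|k IH]; first exact: (derivation_nat 1).
by rewrite exprS; apply: derivation_kerM.
Qed.

End Derivations.

(** * Orders of differential polynomials under division *)

Section DifferentialOrder.

Variables (K : fieldType) (n : nat).
Implicit Types (v w : dvar n) (f g h : dpoly K n).

(** Differential polynomials are generated as a ring by the constants and the
    variables; the monomials are reached by induction on their degree. *)
Lemma dpoly_ind (P : dpoly K n -> Prop) :
  (forall c, P c%:MP) -> (forall v, P (dX K v)) ->
  (forall f g, P f -> P g -> P (f + g)) ->
  (forall f g, P f -> P g -> P (f * g)) -> forall f, P f.
Proof.
move=> PC PX PD PM.
have PU c (m : dmonom n) : P << c *g m >>.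
  have [k le_k] : exists k, (mdeg m <= k)%N by exists (mdeg m).
  elim: k => [|k IH] in m le_k *.
    by have -> : m = mone by apply/mdeg_eq0I/eqP; rewrite -leqn0.
  have [/eqP m0|/fset0Pn[v vm]] := boolP (finsupp m == fset0)%fset.
    have -> : m = mone by apply: mdeg_eq0I; rewrite mdegE m0 big_seq_fset0.
    exact: PC.
  have mE : m = mmul (ucm v) (divcm m (ucm v)).
    apply/eqP/cmP => i; rewrite cmM divcmE cmU; case: eqP => [<-|_] /=.
      by rewrite subnKC // lt0n cmE_neq0.
    by rewrite subn0.
  have -> : << c *g m >> = dX K v * << c *g divcm m (ucm v) >>.
    by rewrite /dX monalgMUU mul1r -mE.
  apply: (PM _ _ (PX v)); apply: IH.
  by rewrite {1}mE mdegM mdegU in le_k.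
move=> f; rewrite [f]monalgE; apply: (big_ind P) => //.
by rewrite -malgC0E.
Qed.

Lemma additive_ext (D E : dpoly K n -> dpoly K n) :
  {morph D : f g / f + g} -> {morph E : f g / f + g} ->
  (forall c m, D << c *g m >> = E << c *g m >>) -> D =1 E.
Proof.
have add0 (F : dpoly K n -> dpoly K n) : {morph F : f g / f + g} -> F 0 = 0.
  by move=> FD; apply: (addrI (F 0)); rewrite -FD !addr0.
move=> DD ED DU f; rewrite [f]monalgE.
elim/big_rec: _ => [|m g _ IH]; first by rewrite !add0.
by rewrite DD ED DU IH.
Qed.

Lemma derivation_ext (D E : dpoly K n -> dpoly K n) :
  derivation D -> derivation E ->
  (forall c, D c%:MP = E c%:MP) -> (forall v, D (dX K v) = E (dX K v)) ->
  D =1 E.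
Proof.
move=> dD dE DC DX; elim/dpoly_ind => // f g Ef Eg.
  by rewrite dD.1 dE.1 Ef Eg.
by rewrite dD.2 dE.2 Ef Eg.
Qed.

Lemma pderiv_comm v w f : pderiv v (pderiv w f) = pderiv w (pderiv v f).
Proof.
have dv := @pderivM K n v; have dw := @pderivM K n w.
apply/eqP; rewrite -subr_eq0; apply/eqP; move: f.
apply: (derivation_ext (derivation_bracket dv dw) (derivation_zero _)) => [c|x].
  by rewrite !pderivC (derivation0 dv) (derivation0 dw) subr0.
by rewrite !pderivX (derivation_nat _ dv) (derivation_nat _ dw) subr0.
Qed.

(** The variable [x_j^(s+1)] enters the derivative of [f] also through
    [x_j^(s)], whose contribution is this term. *)
Definition ddprev v f : dpoly K n :=
  if v.2 is s.+1 then pderiv (v.1, s) f else 0.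

(** The bracket of two derivations is a derivation, so it suffices to compare
    both sides on constants and on variables. *)
Lemma pderiv_dder dK (dK_der : derivation dK) v f :
  pderiv v (dder dK f) = dder dK (pderiv v f) + ddprev v f.
Proof.
have dv := @pderivM K n v; have dd := dderM n dK_der.
have dp : derivation (ddprev v).
  rewrite /ddprev; case: v.2 => [|s]; first exact: derivation_zero.
  exact: pderivM.
apply/eqP; rewrite addrC -subr_eq; apply/eqP; move: f.
apply: (derivation_ext (derivation_bracket dv dd) dp) => [c|x].
  have E1 : pderiv v (dder dK c%:MP) = 0 :> dpoly K n.
    exact: etrans (congr1 _ (dderC n dK_der c)) (pderivC v (dK c)).
  have E2 : dder dK (pderiv v c%:MP) = 0 :> dpoly K n.
    exact: etrans (congr1 _ (pderivC v c)) (derivation0 dd).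
  rewrite E1 E2 subr0 /ddprev.
  by case: v.2 => [|s]; [|exact/esym/pderivC].
have E1 : pderiv v (dder dK (dX K x)) = ((x.1, x.2.+1) == v)%:R.
  exact: etrans (congr1 _ (dderX dK_der x)) (pderivX K v _).
have E2 : dder dK (pderiv v (dX K x)) = 0.
  exact: etrans (congr1 _ (pderivX K v x)) (derivation_nat _ dd).
rewrite E1 E2 subr0 /ddprev.
case: v {dv dp E1 E2} x => j [|s] [i t] /=; first by case: eqP => // -[].
by apply: esym; apply: etrans (pderivX K _ _) _;
  congr (_%:R); rewrite !xpair_eqE eqSS.
Qed.

Lemma coefvU v d c (m : dmonom n) :
  coefv v d << c *g m >> =
  if m v == d then << c *g divcm m (expcmn (ucm v) d) >> else 0 :> dpoly K n.
Proof.
rewrite /coefv big_mkcond /=.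
apply: (big_msuppU (F := fun (k : dmonom n) x => if k v == d
  then << x *g divcm k (expcmn (ucm v) d) >> else 0 : dpoly K n)) => k.
by case: ifP => // _; rewrite monalgU0.
Qed.

Lemma coefvD v d : {morph @coefv K n v d : f g / f + g}.
Proof.
move=> f g; rewrite /coefv !(big_mkcond (fun m : dmonom n => m v == d)) /=.
apply: (big_msuppD (F := fun (k : dmonom n) x => if k v == d
  then << x *g divcm k (expcmn (ucm v) d) >> else 0 : dpoly K n)) => k.
  by case: ifP => // _; rewrite monalgU0.
move=> x y; case: (k v == d).
  exact: monalgDU.
exact: esym (addr0 _).
Qed.

Lemma coefv0 v d : coefv v d (0 : dpoly K n) = 0.
Proof. by rewrite /coefv msupp0 big_nil. Qed.

Lemma pderiv_coefv v w d f : w != v ->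
  pderiv w (coefv v d f) = coefv v d (pderiv w f).
Proof.
move=> wv; have dw := @pderivM K n w; move: f.
apply: additive_ext => [f g|f g|c m].
- exact: etrans (congr1 _ (coefvD _ _ f g)) (dw.1 _ _).
- exact: etrans (congr1 _ (dw.1 f g)) (coefvD _ _ _ _).
rewrite coefvU [X in coefv v d X]pderivU [RHS]coefvU.
rewrite divcmE cmU (negPf wv) subn0.
case: eqP => _; last exact: derivation0.
rewrite [LHS]pderivU.
have expE k i : expcmn (ucm v) k i = ((v == i) * k)%N.
  elim: k => [|k IH]; first by rewrite muln0 cm1.
  have -> : expcmn (ucm v) k.+1 = mmul (ucm v) (expcmn (ucm v) k).
    by case: k {IH} => [|k] //; apply/esym/mulm1.
  by rewrite cmM IH cmU mulnS.
have -> : divcm m (expcmn (ucm v) d) w = m w.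
  by rewrite divcmE expE eq_sym (negPf wv) mul0n subn0.
apply: (congr1 (mkmalgU^~ _)).
by apply/eqP/cmP => i; rewrite !divcmE subnAC.
Qed.

(** Bounds the order in [x_j] by [x] without the value given to absent
    variables, which differs between the conventions; as the common kernel of
    derivations, the polynomials so bounded form a ring. *)
Definition ord_below (j : 'I_n) (x : trop) f :=
  forall s, ~~ tle (Some s) x -> pderiv (j, s) f = 0.

Lemma ord_belowW j x y f : tle x y -> ord_below j x f -> ord_below j y f.
Proof.
move=> le_xy fx s sy; apply: fx; apply: contra sy => sx.
exact: tle_trans sx le_xy.
Qed.

Lemma ord_below_dord cv j f : ord_below j (dord cv j f) f.
Proof.
case: (dordP cv j f) => [[r [-> _ le_r]]|[f0 _]] s; last by rewrite f0.
by move=> /= sr; apply/eqP/negPn; apply: contra sr; apply: le_r.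
Qed.

Lemma dord_le cv j x f :
  tle (ord_empty cv) x -> ord_below j x f -> tle (dord cv j f) x.
Proof.
move=> ex fx; case: (dordP cv j f) => [[r [-> nz _]]|[_ -> //]].
by apply: contraNT nz => /fx ->.
Qed.

Lemma ord_below_dder dK j x f : derivation dK ->
  ord_below j x f -> ord_below j (tadd x (Some 1%N)) (dder dK f).
Proof.
move=> dK_der fx s sx.
apply: etrans (pderiv_dder dK_der _ _) _.
have -> : pderiv (j, s) f = 0.
  by apply: fx; case: x sx => //= x; lia.
rewrite (derivation0 (dderM n dK_der)) add0r.
rewrite /ddprev; case: s sx => //= s sx; apply: fx.
by case: x sx => //= x; lia.
Qed.

Lemma ord_below_iter_dder dK j x k f : derivation dK ->
  ord_below j x f -> ord_below j (tadd x (Some k)) (iter k (dder dK) f).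
Proof.
move=> dK_der fx; elim: k => [|k IH]; first by rewrite taddC tadd0x.
have -> : tadd x (Some k.+1) = tadd (tadd x (Some k)) (Some 1%N).
  by rewrite -taddA /= addn1.
exact: ord_below_dder.
Qed.

(** A reduction step adds to a multiple of [h] a multiple of the derivative of
    [g] of order [r - a], where [r] is the order of [h] in [x_j0]. By this same
    statement for [j0], the orders in [x_j0] never exceed [a + e], hence
    [r - a <= e], and the orders of [g] rise by at most [e] in every variable.
    The last hypothesis concerns the factor [x_j0^(r)] of the quotient. *)
Lemma ritt_reduction_ord dK cv j0 f g a e s Q h : derivation dK ->
  ord_below j0 (Some a) g -> ord_below j0 (Some (a + e)%N) f ->
  ritt_reduction cv dK j0 f g a s Q h ->
  forall j x y, ord_below j x g -> ord_below j y f ->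
    (j = j0 -> tle (Some (a + e)%N) y) ->
    ord_below j (tmax y (tadd x (Some e))) h.
Proof.
move=> dK_der g0 f0; elim=> [|{}s {}Q {}h r _ IH hr ar sg d q] j x y gx fy yj.
  by apply: ord_belowW fy; apply: tle_maxl.
have le_r : (r <= a + e)%N.
  have := IH j0 _ _ g0 f0; rewrite /= maxnn => /(_ (fun=> leqnn _)) h0.
  by have := dord_le (cv := cv) _ h0; rewrite hr; apply; case: (cv).
move=> t tz; pose v := (j, t) : dvar n.
have dv := @pderivM K n v.
have vh : pderiv v h = 0 by apply: IH tz.
have vr : v != (j0, r).
  apply/eqP => -[jj0 tr]; have := yj jj0; case: (y) (x) tz => // y' [x'|] /=;
    rewrite tr; lia.
have vsg : pderiv v sg = 0.
  apply: etrans (pderiv_comm _ _ _) _.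
  have -> : pderiv v g = 0.
    by apply: gx; case: (y) (x) tz => [y'|] [x'|] //=; lia.
  exact: derivation0 (@pderivM K n _).
have vg : pderiv v (iter (r - a) (dder dK) g) = 0.
  have := ord_below_iter_dder (k := (r - a)%N) dK_der gx; apply.
  by case: (y) (x) tz => [y'|] [x'|] //=; lia.
have vq : pderiv v q = 0.
  apply: (derivation_kerM dv).
    by rewrite (pderiv_coefv _ _ vr) vh coefv0.
  by apply: (derivation_kerX _ dv); rewrite pderivX eq_sym (negPf vr).
have vsgh := derivation_kerM dv vsg vh.
exact: derivation_kerB dv vsgh (derivation_kerM dv vq vg).
Qed.

End DifferentialOrder.

(** * Jacobi numbers *)

Lemma ordmxE (K : fieldType) n cv (u : 'I_n -> dpoly K n) i j :
  ordmx cv u i j = dord cv j (u i).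
Proof. exact: mxE. Qed.

Theorem proposition5p4 (K : fieldType) (dK : K -> K)
    (dK_der : derivation dK) (K_char0 : [pchar K] =i pred0)
    (cv : convention) (n : nat) (u : 'I_n.+1 -> dpoly K n.+1)
    (u_form : ritt_second_form (ordmx cv u))
    (s : dpoly K n.+1) (Q : diffop K n.+1) (h : dpoly K n.+1)
    (h_rem : ritt_remainder cv dK ord0 (u ord_max) (u ord0) s Q h) :
  tle (jacobi_number cv (replace_last u h)) (jacobi_number cv u).
Proof.
case: h_rem => a [ga _ h_red _].
have [_ _ _] := u_form; rewrite !mxE => uN0.
have : tle (Some a) (dord cv ord0 (u ord_max)).
  rewrite uN0 -ga.
  have := @tle_bigmax _ (index_enum 'I_n.+1) predT
    (fun i => ordmx cv u i ord0) ord0 (mem_index_enum _) isT.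
  by rewrite mxE.
case fb : (dord cv ord0 (u ord_max)) => [b|] //= le_ab.
have bE : b = (a + (b - a))%N by rewrite subnKC.
apply: (tdet_replace_last (a := a) (e := (b - a)%N) u_form).
- by rewrite mxE ga.
- by rewrite mxE fb -bE.
- move=> i j iN.
  have uE : replace_last u h i = u i by rewrite /replace_last (negPf iN).
  exact: etrans (ordmxE _ _ _ _) (etrans (congr1 (dord cv j) uE)
    (esym (ordmxE _ _ _ _))).
have hN : replace_last u h ord_max = h by rewrite /replace_last eqxx.
move=> j; rewrite [X in tle X _]ordmxE hN.
rewrite (ordmxE cv u ord_max) (ordmxE cv u ord0).
apply: dord_le; first exact: tle_trans (tle_maxl _ _) (tle_maxl _ _).
apply: (ritt_reduction_ord dK_der _ _ h_red); try exact: ord_below_dord.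
- by rewrite -ga; apply: ord_below_dord.
- by rewrite -bE -fb; apply: ord_below_dord.
by move=> ->; rewrite fb -bE /=.
Qed.
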